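(* Let $\mathbb{F}$ be a finite field with $q$ elements and $n\ge 2$ an integer. Let $N=\frac{q^n-1}{q-1}$ and let $v_1,\dots,v_N$ be an enumeration of the $1$-dimensional subspaces of $\mathbb{F}^n$. Let $K$ be a field of characteristic zero, $R=K[X_1,\dots,X_N]$, $Q=K[x_1,\dots,x_N]$ acting on $R$ by $x_i\circ f=\partial f/\partial X_i$. Let $F=\sum X_{i_1}X_{i_2}\cdots X_{i_n}$, the sum over all $1\le i_1<\cdots<i_n\le N$ such that $v_{i_1},\dots,v_{i_n}$ form a basis of $\mathbb{F}^n$, and let $\mathcal{A}=Q/\operatorname{Ann}_Q(F)$ with graded components $\mathcal{A}_k$. For each $j$, let $x_j^\perp\in\mathcal{A}_{n-1}$ be the image of the monomial $x_{k_1}\cdots x_{k_{n-1}}$ where $v_{k_1},\dots,v_{k_{n-1}}$ form a basis of the hyperplane $v_j^\perp=\{w:\sum_i (v_j)_iw_i=0\}$ (this class is independent of the chosen basis). Let $\ell=x_1+\cdots+x_N$, and let $M=(m_{ij})$ be the matrix of the $K$-linear map $\mathcal{A}_1\to\mathcal{A}_{n-1}$, $u\mapsto \ell^{n-2}u$, with respect to the bases $\{x_1,\dots,x_N\}$ of $\mathcal{A}_1$ and $\{x_1^\perp,\dots,x_N^\perp\}$ of $\mathcal{A}_{n-1}$. Let $A$ be the $N\times N$ matrix with $a_{ij}=1$ if $v_i\in v_j^\perp$ and $a_{ij}=0$ otherwise. Then $M=t_{n-1,1,q}\,A$, where $t_{n-1,1,q}=q^{(n-1)(n-2)/2}\prod_{k=1}^{n-2}\frac{q^k-1}{q-1}$,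 and consequently $|\det M|=t_{n-1,1,q}^{\,N}\,|\det A|$.
   Context: $\operatorname{Ann}_Q(F)=\{f\in Q: f\circ F=0\}$. It is known (Maeno–Numata) that $\{x_1,\dots,x_N\}$ and $\{x_1^\perp,\dots,x_N^\perp\}$ are $K$-bases of $\mathcal{A}_1$ and $\mathcal{A}_{n-1}$ respectively. The number $t_{n-1,1,q}$ is the number of ordered $(n-1)$-tuples of $1$-dimensional subspaces forming a basis of an $(n-1)$-dimensional space and starting with a fixed $1$-dimensional subspace. *)

(* Defs.v *)
From HB Require Import structures.
From mathcomp Require Import all_boot all_order all_algebra.
From mathcomp Require Import generic_quotient ring_quotient ssrcomplements mpoly.

Set Implicit Arguments.
Unset Strict Implicit.
Unset Printing Implicit Defensive.

Import GRing.Theory.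
Local Open Scope ring_scope.
Local Open Scope quotient_scope.

(* The algebra Q / Ann_Q(G) attached to a polynomial G, where Q acts on R by
   differentiation. Both polynomial rings are {mpoly K[N]}. *)

Section Apolarity.
Variables (N : nat) (K : fieldType).
Implicit Types (f g G : {mpoly K[N]}).

(* diffact G f is f o G, with x_i acting as the derivative in X_i. *)
Definition diffact G f : {mpoly K[N]} :=
  \sum_(m <- msupp f) f@_m *: G^`M[m].

Lemma diffactwE k f G : (msize f <= k)%N ->
  diffact G f = \sum_(m : 'X_{1..N < k}) f@_m *: G^`M[m].
Proof.
move=> le_fk; rewrite /diffact (big_mksub 'X_{1..N < k}) //=; first last.
- by move=> x /msize_mdeg_lt /leq_trans; apply.
- exact: msupp_uniq.
rewrite big_rmcond //= => m mNf.
by rewrite memN_msupp_eq0 // scale0r.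
Qed.

Lemma diffact_is_linear G : linear (diffact G).
Proof.
move=> c f g; set k := maxn (msize (c *: f + g)) (maxn (msize f) (msize g)).
rewrite !(@diffactwE k) ?leq_max ?leqnn ?orbT // scaler_sumr -big_split /=.
by apply: eq_bigr => m _; rewrite mcoeffD mcoeffZ scalerDl scalerA.
Qed.

HB.instance Definition _ G := GRing.isLinear.Build K {mpoly K[N]} {mpoly K[N]}
  _ (diffact G) (diffact_is_linear G).

Lemma diffactX m G : diffact G 'X_[m] = G^`M[m].
Proof. by rewrite /diffact msuppX big_seq1 mcoeffX eqxx scale1r. Qed.

Lemma diffactM f g G : diffact G (f * g) = diffact (diffact G g) f.
Proof.
rewrite {1}[f]mpolyE mulr_suml (linear_sum (diffact G)) /=.
apply: eq_bigr => m _.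
rewrite -scalerAl (linearZ_LR (diffact G)) /=; congr (_ *: _).
rewrite {1}[g]mpolyE mulr_sumr (linear_sum (diffact G)) /= linear_sum /=.
apply: eq_bigr => m' _.
rewrite -scalerAr (linearZ_LR (diffact G)) /= mderivmZ -mpolyXD diffactX.
by rewrite addmC mderivmDm.
Qed.

Definition Ann G : {pred {mpoly K[N]}} := fun f => diffact G f == 0.

Lemma Ann_zmod_closed G : zmod_closed (Ann G).
Proof.
split=> [|f g]; rewrite !unfold_in; first by rewrite (linear0 (diffact G)).
move=> /eqP f0 /eqP g0.
by rewrite (linearB (diffact G)) /= f0 g0 subr0.
Qed.

HB.instance Definition _ G :=
  GRing.isZmodClosed.Build {mpoly K[N]} (Ann G) (Ann_zmod_closed G).

Lemma Ann_mull G f g : g \in Ann G -> f * g \in Ann G.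
Proof.
rewrite !unfold_in => /eqP g0; rewrite diffactM g0 /diffact.
by rewrite big1 // => m _; rewrite linear0 scaler0.
Qed.

Lemma Ann_mulr G f g : f \in Ann G -> f * g \in Ann G.
Proof. by rewrite mulrC; apply: Ann_mull. Qed.

(* The ring structure is not taken from {ideal_quot _}, which requires the
   ideal to be proper, i.e. G != 0. For the same reason (apolar_alg G) is a
   comPzRingType and a vectType rather than a falgType; aa_scaleAl and
   aa_scaleAr link its two structures. *)
Definition apolar_alg G : Type := {ideal_quot Ann G}.

HB.instance Definition _ G := GRing.Zmodule.on (apolar_alg G).

Section Algebra.
Variable G : {mpoly K[N]}.
Local Notation A := (apolar_alg G).

Definition cls f : A := \pi_({ideal_quot Ann G}) f.

Definition aa_repr (u : A) : {mpoly K[N]} := repr (u : {ideal_quot Ann G}).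

Lemma aa_reprK u : cls (aa_repr u) = u.
Proof. exact: reprK. Qed.

Lemma cls_eq f g : (cls f == cls g) = (f - g \in Ann G).
Proof. by rewrite Quotient.idealrBE. Qed.

Lemma cls_sub : {morph cls : f g / f - g}.
Proof. exact: (raddfB \pi_({ideal_quot Ann G})). Qed.

Lemma cls_add : {morph cls : f g / f + g}.
Proof. exact: (raddfD \pi_({ideal_quot Ann G})). Qed.

Definition aa_mul (u w : A) : A := cls (aa_repr u * aa_repr w).
Definition aa_scale (c : K) (u : A) : A := cls (c *: aa_repr u).

Lemma cls_mul f g : cls (f * g) = aa_mul (cls f) (cls g).
Proof.
apply/eqP; rewrite cls_eq -[X in X - _](subrK (aa_repr (cls f) * g)).
rewrite -addrA -mulrBl -mulrBr rpredD //.
- by apply: Ann_mulr; rewrite -cls_eq aa_reprK.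
- by apply: Ann_mull; rewrite -cls_eq aa_reprK.
Qed.

Lemma cls_scale c f : cls (c *: f) = aa_scale c (cls f).
Proof.
apply/eqP; rewrite cls_eq -scalerBr -mul_mpolyC.
by apply: Ann_mull; rewrite -cls_eq aa_reprK.
Qed.

Lemma aa_mulA : associative aa_mul.
Proof.
by move=> u v w; rewrite -[u]aa_reprK -[v]aa_reprK -[w]aa_reprK -!cls_mul mulrA.
Qed.
Lemma aa_mulC : commutative aa_mul.
Proof. by move=> u v; rewrite -[u]aa_reprK -[v]aa_reprK -!cls_mul mulrC. Qed.
Lemma aa_mul1 : left_id (cls 1) aa_mul.
Proof. by move=> u; rewrite -[u]aa_reprK -!cls_mul mul1r. Qed.
Lemma aa_mulDl : left_distributive aa_mul +%R.
Proof.
move=> u v w; rewrite -[u]aa_reprK -[v]aa_reprK -[w]aa_reprK.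
by rewrite -cls_add -!cls_mul mulrDl cls_add.
Qed.
Lemma aa_mul0 : left_zero 0 aa_mul.
Proof.
by move=> u; apply: (@addrI _ (aa_mul 0 u)); rewrite -aa_mulDl !addr0.
Qed.

HB.instance Definition _ := GRing.Zmodule_isComPzRing.Build A
  aa_mulA aa_mulC aa_mul1 aa_mulDl.

Lemma aa_scaleA c d u : aa_scale c (aa_scale d u) = aa_scale (c * d) u.
Proof. by rewrite -[u]aa_reprK -!cls_scale scalerA. Qed.
Lemma aa_scale1 : left_id 1 aa_scale.
Proof. by move=> u; rewrite -[u]aa_reprK -!cls_scale scale1r. Qed.
Lemma aa_scaleDr : right_distributive aa_scale +%R.
Proof.
move=> c u v; rewrite -[u]aa_reprK -[v]aa_reprK.
by rewrite -cls_add -!cls_scale scalerDr cls_add.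
Qed.
Lemma aa_scaleDl u : {morph aa_scale^~ u : c d / c + d}.
Proof.
by move=> c d; rewrite -[u]aa_reprK -!cls_scale scalerDl cls_add.
Qed.

HB.instance Definition _ := GRing.Zmodule_isLmodule.Build K A
  aa_scaleA aa_scale1 aa_scaleDr aa_scaleDl.

Lemma aa_scaleAl (c : K) (u v : A) : c *: (u * v) = c *: u * v.
Proof.
rewrite -[u]aa_reprK -[v]aa_reprK -[_ * _]cls_mul.
by rewrite -[LHS]cls_scale -[c *: _]cls_scale -[RHS]cls_mul scalerAl.
Qed.

Lemma aa_scaleAr (c : K) (u v : A) : c *: (u * v) = u * (c *: v).
Proof. by rewrite mulrC aa_scaleAl mulrC. Qed.

Lemma cls_is_linear : linear cls.
Proof. by move=> c f g; rewrite cls_add cls_scale. Qed.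
HB.instance Definition _ :=
  GRing.isLinear.Build K {mpoly K[N]} A _ cls cls_is_linear.
Lemma cls_is_monoid_morphism : monoid_morphism cls.
Proof. by split=> // f g; apply: cls_mul. Qed.
HB.instance Definition _ :=
  GRing.isMonoidMorphism.Build {mpoly K[N]} A cls cls_is_monoid_morphism.

Lemma cls_eq0 f : (cls f == 0) = (diffact G f == 0).
Proof. by rewrite -(linear0 cls) cls_eq subr0. Qed.


(* A finite basis: A embeds in the space of coefficient vectors of partial
   derivatives of G. *)
Local Notation B := 'X_{1..N < msize G}.
Local Notation W := 'rV[K]_#|{: B}|.

Definition aa_coefs (u : A) : W :=
  \row_i (diffact G (aa_repr u))@_(bmnm (enum_val i : B)).

Lemma aa_coefs_cls f :
  aa_coefs (cls f) = \row_i (diffact G f)@_(bmnm (enum_val i : B)).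
Proof.
apply/rowP => i; rewrite !mxE; congr (_@_ _).
apply/eqP; rewrite -subr_eq0 -(linearB (diffact G)) /= -cls_eq0 linearB /=.
by rewrite aa_reprK subrr.
Qed.

Lemma aa_coefs_is_linear : linear aa_coefs.
Proof.
move=> c u v; rewrite -[u]aa_reprK -[v]aa_reprK.
rewrite -cls_is_linear !aa_coefs_cls.
by apply/rowP => i; rewrite !mxE linearP /= mcoeffD mcoeffZ.
Qed.

HB.instance Definition _ :=
  GRing.isLinear.Build K A W _ aa_coefs aa_coefs_is_linear.

Lemma mderivm_coef_eq0 m m' :
  (msize G <= mdeg m + mdeg m')%N -> (G^`M[m])@_m' = 0.
Proof.
move=> le_G; rewrite mcoeff_mderivm memN_msupp_eq0 ?mul0rn //.
by apply: msize_mdeg_ge; rewrite mdegD.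
Qed.

Lemma diffact_coef_eq0 f m : (msize G <= mdeg m)%N -> (diffact G f)@_m = 0.
Proof.
move=> le_G; rewrite /diffact linear_sum /= big1 // => m' _.
by rewrite mcoeffZ mderivm_coef_eq0 ?mulr0 // (leq_trans le_G) ?leq_addl.
Qed.

Lemma clsX_eq0 m : (msize G <= mdeg m)%N -> cls 'X_[m] = 0.
Proof.
move=> le_G; apply/eqP; rewrite cls_eq0 diffactX; apply/eqP/mpolyP => m'.
by rewrite mcoeff0 mderivm_coef_eq0 // (leq_trans le_G) ?leq_addr.
Qed.

Lemma aa_coefs_inj : injective aa_coefs.
Proof.
apply: raddf_inj => u; rewrite -[u]aa_reprK /= aa_coefs_cls => /rowP u0.
apply/eqP; rewrite cls_eq0; apply/eqP/mpolyP => m; rewrite mcoeff0.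
have [le_G|lt_G] := leqP (msize G) (mdeg m); first exact: diffact_coef_eq0.
have := u0 (enum_rank (BMultinom lt_G)).
by rewrite !mxE enum_rankK.
Qed.

Definition aa_img : {vspace W} :=
  <<[seq aa_coefs (cls 'X_[bmnm m]) | m : B]>>%VS.

Lemma aa_coefs_img u : aa_coefs u \in aa_img.
Proof.
rewrite -[u]aa_reprK [aa_repr u]mpolyE linear_sum linear_sum /=.
apply: rpred_sum => m _; rewrite !linearZ /= rpredZ //.
have [le_G|lt_G] := leqP (msize G) (mdeg m).
  by rewrite clsX_eq0 // linear0 mem0v.
by apply/memv_span/imageP; exists (BMultinom lt_G).
Qed.

Lemma aa_img_lift w : w \in aa_img -> exists u, aa_coefs u = w.
Proof.
move=> w_img; rewrite (coord_span w_img); set s := image_tuple _ _.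
exists (\sum_i coord s i w *: cls 'X_[bmnm (enum_val i : B)]).
rewrite linear_sum; apply: eq_bigr => i _; rewrite linearZ /=.
by congr (_ *: _); rewrite nth_image.
Qed.

Definition aa_vec (u : A) : 'rV[K]_(\dim aa_img) :=
  \row_i coord (vbasis aa_img) i (aa_coefs u).

Lemma aa_vector_axiom : Vector.axiom (\dim aa_img) A.
Proof.
exists aa_vec.
  by move=> c u v; apply/rowP => i; rewrite !mxE !linearP.
have inj_vec : injective aa_vec.
  move=> u v /rowP uv; apply: aa_coefs_inj.
  rewrite (coord_vbasis (aa_coefs_img u)) (coord_vbasis (aa_coefs_img v)).
  by apply: eq_bigr => i _; have := uv i; rewrite !mxE => ->.
have lift (r : 'rV[K]_(\dim aa_img)) : exists u, aa_vec u == r.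
  have w_img : \sum_i r 0 i *: (vbasis aa_img)`_i \in aa_img.
    by apply: rpred_sum => i _; rewrite rpredZ ?vbasis_mem ?memt_nth.
  have [u u_w] := aa_img_lift w_img; exists u; apply/eqP/rowP => i.
  by rewrite mxE u_w coord_sum_free ?(basis_free (vbasisP _)).
exists (fun r => xchoose (lift r)) => [u|r]; last exact/eqP/(xchooseP (lift r)).
by apply: inj_vec; apply/eqP/(xchooseP (lift (aa_vec u))).
Qed.

HB.instance Definition _ := Lmodule_hasFinDim.Build K A aa_vector_axiom.

(* A_k, the image of the forms of degree k; see grcompP. *)
Definition grcomp (k : nat) : {vspace A} :=
  <<[seq cls 'X_[bmnm m] |
     m : 'X_{1..N < k.+1} in [pred m | mdeg (bmnm m) == k]]>>%VS.

Lemma grcompP k u :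
  reflect (exists2 f, f \is k.-homog & u = cls f) (u \in grcomp k).
Proof.
apply: (iffP idP) => [u_k|[f /dhomogP f_k ->]]; last first.
  rewrite [f]mpolyE linear_sum big_seq rpred_sum // => m /f_k m_k.
  rewrite linearZ rpredZ //; apply: memv_span.
  have lt_m : (mdeg m < k.+1)%N by rewrite ltnS [mdeg m]m_k.
  by apply/imageP; exists (BMultinom lt_m); rewrite //= inE; apply/eqP.
rewrite (coord_span u_k); set s := image_tuple _ _.
pose P (w : A) := exists2 f, f \is k.-homog & w = cls f.
apply: (big_ind P) => [|_ _ [f f_k ->] [g g_k ->]|i _].
- by exists 0; rewrite ?rpred0 ?linear0.
- by exists (f + g); rewrite ?rpredD ?linearD.
have : s`_i \in s by rewrite mem_nth // size_tuple.
case/imageP => m m_k ->; exists (coord s i u *: 'X_[bmnm m]).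
  by rewrite rpredZ // dhomogX.
by rewrite linearZ.
Qed.

Lemma grcompM j k u w :
  u \in grcomp j -> w \in grcomp k -> u * w \in grcomp (j + k).
Proof.
move=> /grcompP[f f_j ->] /grcompP[g g_k ->]; apply/grcompP.
by exists (f * g); rewrite ?dhomogM // rmorphM.
Qed.

Lemma grcompX i : cls 'X_i \in grcomp 1.
Proof. by apply/grcompP; exists 'X_i; rewrite // dhomogX; apply/eqP/mdeg1. Qed.

Lemma grcomp_prodX k (s : k.-tuple 'I_N) :
  cls (\prod_(i <- s) 'X_i) \in grcomp k.
Proof.
case: s => s /= /eqP <-; elim: s => [|i s IHs] /=.
  rewrite big_nil; apply/grcompP; exists 1 => //; exact: dhomog1.
by rewrite big_cons rmorphM; apply: (@grcompM 1) => //; apply: grcompX.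
Qed.

Definition ell : A := \sum_i cls 'X_i.

Lemma grcomp_ell k : ell ^+ k \in grcomp k.
Proof.
elim: k => [|k IHk].
  by rewrite expr0; apply/grcompP; exists 1; [apply: dhomog1 | rewrite rmorph1].
rewrite exprS; apply: (@grcompM 1) => //.
by apply: rpred_sum => i _; apply: grcompX.
Qed.

(* Multiplication by u, as a map from the subspace U to the subspace V. It is
   meaningful when u * U is contained in V; see mulhomE. *)
Definition mulmap (U V : {vspace A}) (u : A) (w : subvs_of U) : subvs_of V :=
  vsproj V (u * vsval w).

Lemma mulmap_is_linear U V u : linear (@mulmap U V u).
Proof.
move=> c w w'; rewrite /mulmap linearP mulrDr linearD /=; congr (_ + _).
by rewrite -aa_scaleAr linearZ.
Qed.

HB.instance Definition _ U V u := GRing.isLinear.Build K (subvs_of U)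
  (subvs_of V) _ (@mulmap U V u) (@mulmap_is_linear U V u).

Definition mulhom (U V : {vspace A}) (u : A) : 'Hom(subvs_of U, subvs_of V) :=
  linfun (@mulmap U V u).

Lemma mulhomE (U V : {vspace A}) (u : A) (w : subvs_of U) :
  u * vsval w \in V -> vsval (mulhom U V u w) = u * vsval w.
Proof. by move=> uw_V; rewrite lfunE /= vsprojK. Qed.

End Algebra.
End Apolarity.

Section MatrixOfMap.
Variables (K : fieldType) (U V : vectType K) (m n : nat).

(* Column j holds the coordinates of phi (e_j) in f. *)
Definition mx_of_hom (e : m.-tuple U) (f : n.-tuple V) (phi : 'Hom(U, V)) :
    'M[K]_(n, m) :=
  \matrix_(i, j) coord f i (phi (tnth e j)).

End MatrixOfMap.

Section Lines.
Variables (F : finFieldType) (n : nat).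
Local Notation vec := 'rV[F]_n.
Implicit Types (L H : {vspace vec}).

Definition nlines : nat := ((#|F| ^ n - 1) %/ (#|F| - 1))%N.

Definition enumerates_lines (v : 'I_nlines -> {vspace vec}) : Prop :=
  injective v /\ forall L, \dim L = 1%N <-> exists i, v i = L.

(* The lines v_i, i in s, form a basis of H; vpick chooses a nonzero vector
   on each line. *)
Definition lines_basis (v : 'I_nlines -> {vspace vec}) H (s : seq 'I_nlines) :=
  basis_of H [seq vpick (v i) | i <- s].

Definition orth L : {vspace vec} := lker (linfun (mulmxr (vpick L)^T)).

Lemma mem_orth L (w : vec) :
  (w \in orth L) = (\sum_i vpick L 0 i * w 0 i == 0).
Proof.
rewrite memv_ker lfunE /=; apply/eqP/eqP => [/matrixP/(_ 0 0)|w0].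
  rewrite !mxE => w0; rewrite -[RHS]w0; apply: eq_bigr => i _.
  by rewrite mxE mulrC.
apply/matrixP => i j; rewrite !ord1 !mxE -[RHS]w0; apply: eq_bigr => k _.
by rewrite mxE mulrC.
Qed.

Definition orth_mx (K : fieldType) (v : 'I_nlines -> {vspace vec}) :
    'M[K]_nlines :=
  \matrix_(i, j) (v i <= orth (v j))%VS%:R.

Definition bases_poly (K : fieldType) (v : 'I_nlines -> {vspace vec}) :
    {mpoly K[nlines]} :=
  \sum_(I : {set 'I_nlines} | (#|I| == n) && lines_basis v fullv (enum I))
    \prod_(i in I) 'X_i.

Definition tnum : nat :=
  (#|F| ^ ((n - 1) * (n - 2) %/ 2) *
   \prod_(1 <= k < n - 1) ((#|F| ^ k - 1) %/ (#|F| - 1)))%N.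

End Lines.

Section BasesOfComponents.
Variables (F : finFieldType) (n : nat) (K : fieldType).
Variable v : 'I_(nlines F n) -> {vspace 'rV[F]_n}.
Local Notation N := (nlines F n).
Local Notation G := (bases_poly K v).

Definition grspace (k : nat) : vectType K := subvs_of (grcomp G k).

Definition xs : N.-tuple (grspace 1) := [tuple Subvs (grcompX G i) | i < N].

(* b j lists the indices of the lines of a basis of the hyperplane orthogonal
   to v j. *)
Definition xs_orth (b : 'I_N -> (n - 1).-tuple 'I_N) : N.-tuple (grspace (n - 1)) :=
  [tuple Subvs (grcomp_prodX G (b j)) | j < N].

Definition ell_map : 'Hom(grspace 1, grspace (n - 1)) :=
  mulhom _ _ (ell G ^+ (n - 2)).

Lemma ell_mapE (w : grspace 1) : (1 < n)%N ->
  vsval (ell_map w) = ell G ^+ (n - 2) * vsval w.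
Proof.
move=> n_gt1; apply: mulhomE.
rewrite (_ : n - 1 = n - 2 + 1)%N; last by rewrite addnBAC // addn1 subSS.
by apply: grcompM; [apply: grcomp_ell | apply: subvsP].
Qed.

End BasesOfComponents.

(* Main.v *)
Require Import Defs.
From mathcomp Require Import all_boot all_order all_algebra all_field.
From mathcomp Require Import mpoly zify ring.
Import GRing.Theory Num.Theory.
Local Open Scope ring_scope.

(** An element of the algebra is determined by its action on the bases
    polynomial G. A product x_s of n - 1 variables sends G to the sum of the
    X_k such that v_k completes s to a basis; for s = b_i this is the sum of the
    X_k with v_k outside the hyperplane H_i = orth v_i. Hence the coefficient of
    X_k in (ell^(n-2) x_j) o G counts the tuples completing v_j, v_k to a basis,
    which is 0 if k = j and t q^(n-2) otherwise, while the number of hyperplanes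
    H_i containing v_j but not v_k is, by the symmetry of orthogonality, 0 if
    k = j and q^(n-2) otherwise. So ell^(n-2) x_j = t * sum of the x_i^perp with
    v_j in H_i. These are the coordinates because the x_i^perp are independent:
    for the non-incidence matrix B of lines and hyperplanes, B^T B equals
    q^(n-2) I + (q^(n-1) - q^(n-2)) J, where J is the all-one matrix, which is
    invertible in characteristic 0. *)

(** * Powers of a sum as sums over tuples *)

Lemma big_tuple_cons (R : Type) (idx : R) (op : Monoid.com_law idx)
    (T : finType) (k : nat) (f : k.+1.-tuple T -> R) :
  \big[op/idx]_(s : k.+1.-tuple T) f s =
  \big[op/idx]_(i : T) \big[op/idx]_(s : k.-tuple T) f [tuple of i :: s].
Proof.
rewrite pair_bigA /=.
rewrite (reindex (fun p : T * k.-tuple T => [tuple of p.1 :: p.2])) //=.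
exists (fun s => (thead s, [tuple of behead s])) => [[i s] _|s _].
  by congr pair; apply: val_inj.
by rewrite -tuple_eta.
Qed.

(** Applied to powers of the sum of the variables, this makes coefficients into counts of ordered
    tuples of lines. *)
Lemma exprn_sum_tuple (R : comPzRingType) (T : finType) (k : nat) (x : T -> R) :
  (\sum_i x i) ^+ k = \sum_(s : k.-tuple T) \prod_(i <- s) x i.
Proof.
elim: k => [|k IHk].
  by rewrite (big_pred1 [tuple]) ?big_nil // => s; apply/esym/eqP; exact: tuple0.
rewrite exprS {}IHk big_tuple_cons big_distrlr /=.
by apply: eq_bigr => i _; apply: eq_bigr => s _; rewrite big_cons.
Qed.

(** For a prime power q, the number of lines in a k-dimensional space over a field with q
    elements. *)
Definition gauss (q k : nat) : nat := ((q ^ k - 1) %/ (q - 1))%N.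

Lemma gaussE (q k : nat) : (1 < q)%N -> (gauss q k * (q - 1) = q ^ k - 1)%N.
Proof.
by move=> q_gt1; rewrite /gauss divnK // !subn1 predn_exp dvdn_mulr.
Qed.

(** * Counting lines and bases *)

Section Lines.
Variables (F : finFieldType) (n : nat).
Variable v : 'I_(nlines F n) -> {vspace 'rV[F]_n}.
Hypothesis v_enum : enumerates_lines v.
Local Notation q := #|F|.
Local Notation N := (nlines F n).
Local Notation vec := 'rV[F]_n.
Local Notation vv i := (vpick (v i)).
Implicit Types (U W : {vspace vec}) (s : seq 'I_N) (i j : 'I_N).

Let q_gt1 : (1 < q)%N := card_finNzRing_gt1 F.

Lemma dim_line i : \dim (v i) = 1%N.
Proof. by case: v_enum => _ v_onto; apply/v_onto; exists i. Qed.

Lemma line_gen_neq0 i : vv i != 0.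
Proof. by rewrite vpick0 -dimv_eq0 dim_line. Qed.

Lemma line_genE i : v i = <[vv i]>%VS.
Proof.
apply/esym/eqP; rewrite eqEdim dim_line dim_vline line_gen_neq0 andbT.
by rewrite -memvE memv_pick.
Qed.

Lemma sub_line i U : (v i <= U)%VS = (vv i \in U).
Proof. by rewrite {1}line_genE memvE. Qed.

Lemma line_onto (x : vec) : x != 0 -> exists i, x \in v i.
Proof.
case: v_enum => _ v_onto x_neq0.
have /v_onto[i v_i] : \dim <[x]> = 1%N by rewrite dim_vline x_neq0.
by exists i; rewrite v_i memv_line.
Qed.

Lemma line_uniq (x : vec) i j : x != 0 -> x \in v i -> x \in v j -> i = j.
Proof.
case: v_enum => v_inj _ x_neq0.
have x_gen k : x \in v k -> v k = <[x]>%VS.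
  by move=> x_k; apply/esym/eqP; rewrite eqEdim dim_line dim_vline x_neq0 -memvE x_k.
by move=> /x_gen v_i /x_gen v_j; apply: v_inj; rewrite v_i.
Qed.

(* The nonzero multiples of the chosen generators of these lines are exactly the
   vectors of U outside W. *)
Lemma card_lines_diff U W : (W <= U)%VS ->
  #|[set i | (v i <= U)%VS && ~~ (v i <= W)%VS]| =
  (q ^ \dim W * gauss q (\dim U - \dim W))%N.
Proof.
move=> sWU; set I := [set i | _].
have dWU := dimvS sWU.
have q1_gt0 : (0 < q - 1)%N by rewrite subn_gt0.
(* Multiplying by q - 1 turns the count of lines into a count of vectors. *)
apply/eqP; rewrite -(eqn_pmul2r q1_gt0) -mulnA gaussE // [X in _ == X]mulnBr muln1 -expnD.
rewrite subnKC // -!card_vspace.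
pose D := setX I [set a : F | a != 0].
pose h (p : 'I_N * F) : vec := p.2 *: vv p.1.
have h_mem (p : 'I_N * F) (V : {vspace vec}) : p.2 != 0 -> (h p \in V) = (v p.1 <= V)%VS.
  by move=> p_neq0; rewrite /h rpredZeq (negbTE p_neq0) sub_line.
have h_neq0 (p : 'I_N * F) : p.2 != 0 -> h p != 0.
  by move=> p_neq0; rewrite scaler_eq0 negb_or p_neq0 line_gen_neq0.
have h_inj : {in D &, injective h}.
  move=> [i a] [j c]; rewrite !inE /= => /andP[_ a_neq0] /andP[_ c_neq0] eq_h.
  have eq_ij : i = j.
    apply: (@line_uniq (h (i, a))); first exact: h_neq0.
      by rewrite h_mem.
    by rewrite eq_h h_mem.
  move: eq_h; rewrite /h /= eq_ij => /eqP.
  rewrite -subr_eq0 -scalerBl scaler_eq0 (negbTE (line_gen_neq0 j)) orbF.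
  by rewrite subr_eq0 => /eqP ->.
have <- : #|[set x in U] :\: [set x in W]| = (#|I| * (q - 1))%N.
  have <- : #|[set a : F | a != 0]| = (q - 1)%N.
    by have := cardsC1 (0 : F); rewrite subn1 => <-; apply: eq_card => a; rewrite !inE.
  rewrite -cardsX -(card_in_imset h_inj); apply: eq_card => x.
  rewrite !inE; apply/andP/imsetP => [[xW xU]|[[i a]]].
    have x_neq0 : x != 0 by apply: contra xW => /eqP ->; apply: mem0v.
    have [i] := line_onto x x_neq0; rewrite line_genE => /vlineP[a x_a].
    have a_neq0 : a != 0 by apply: contra x_neq0 => /eqP a0; rewrite x_a a0 scale0r.
    by exists (i, a); rewrite // !inE a_neq0 -!(h_mem (i, a)) // /h /= -x_a xU xW.
  by rewrite !inE /= => /andP[/andP[iU iW] a_neq0] ->; rewrite !h_mem.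
rewrite cardsD (setIidPr _); last by apply/subsetP=> x; rewrite !inE; apply: (subvP sWU).
by rewrite !cardsE.
Qed.

(** The lines are chosen one at a time: each new one lies in U but outside the span of the earlier
    ones, whose dimension is their number, so [card_lines_diff] gives each factor. *)
Lemma card_line_extensions U s : free [seq vv i | i <- s] ->
    (forall i, i \in s -> (v i <= U)%VS) -> forall k,
  #|[set r : k.-tuple 'I_N | free [seq vv i | i <- s ++ r] &&
       all (fun i => (v i <= U)%VS) r]| =
  (\prod_(j < k) (q ^ (size s + j) * gauss q (\dim U - (size s + j))))%N.
Proof.
move=> s_free s_U k; elim: k s s_free s_U => [|k IHk] s s_free s_U.
  rewrite big_ord0 (eq_card (B := [set [tuple]])) ?cards1 // => r.
  by rewrite tuple0 !inE /= cats0 s_free eqxx.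
rewrite -sum1_card big_mkcond big_tuple_cons /=.
set W := <<[seq vv i | i <- s]>>%VS.
have dW : \dim W = size s by move: s_free; rewrite /free => /eqP; rewrite size_map.
have W_U : (W <= U)%VS.
  by apply/span_subvP => _ /mapP[i /s_U i_U ->]; rewrite -sub_line.
rewrite big_ord_recl addn0 /= -dW -card_lines_diff // -sum_nat_const.
(* A first line outside U or inside W admits no extension, so only the others contribute. *)
rewrite [LHS](bigID (mem [set i | (v i <= U)%VS && ~~ (v i <= W)%VS])) /=.
have perm_i i (r : seq 'I_N) :
    free [seq vv j | j <- s ++ i :: r] = free [seq vv j | j <- (i :: s) ++ r].
  by apply/perm_free/perm_map; rewrite perm_catC /= perm_cons perm_catC.
rewrite [X in (_ + X)%N]big1 ?addn0 => [|i]; last first.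
  rewrite inE sub_line negb_and negbK => i_out.
  apply: big1 => r _; rewrite inE /= perm_i.
  case: ifP => // /and3P[i_free i_U _]; move: i_out; rewrite -sub_line i_U /=.
  rewrite sub_line; move: i_free; rewrite /= free_cons map_cat span_cat.
  by case/andP => /negP i_s _ /(subvP (addvSl _ _)) /i_s.
apply: eq_bigr => i; rewrite inE sub_line => /andP[i_U i_W].
transitivity #|[set r : k.-tuple 'I_N | free [seq vv j | j <- (i :: s) ++ r] &&
       all (fun j => (v j <= U)%VS) r]|.
  rewrite -sum1_card [RHS]big_mkcond; apply: eq_bigr => r _.
  by rewrite !inE /= perm_i sub_line i_U.
rewrite IHk /=.
- by apply: eq_bigr => j _; rewrite addSnnS dW /bump leq0n add1n.
- by rewrite free_cons s_free -sub_line i_W.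
- by move=> j; rewrite inE => /predU1P[->|/s_U //]; rewrite sub_line.
Qed.

Lemma lines_basis_free U s : size s = \dim U ->
  lines_basis v U s =
  free [seq vv i | i <- s] && all (fun i => (v i <= U)%VS) s.
Proof.
move=> size_s; rewrite /lines_basis basisEfree size_map size_s leqnn andbT.
congr (_ && _); apply/span_subvP/idP.
  move=> s_U; apply/allP => i i_s; rewrite sub_line; apply: s_U.
  exact: (map_f (fun i => vv i)).
by move=> s_U _ /mapP[i i_s ->]; rewrite -sub_line; apply: (allP s_U).
Qed.

Lemma card_basis_extensions U s k :
    free [seq vv i | i <- s] -> (forall i, i \in s -> (v i <= U)%VS) ->
    (size s + k)%N = \dim U ->
  #|[set r : k.-tuple 'I_N | lines_basis v U (s ++ r)]| =
  (\prod_(j < k) (q ^ (size s + j) * gauss q (k - j)))%N.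
Proof.
move=> s_free s_U dU; transitivity (\prod_(j < k)
    (q ^ (size s + j) * gauss q (\dim U - (size s + j))))%N.
  rewrite -card_line_extensions //; apply: eq_card => r.
  rewrite !inE lines_basis_free ?size_cat ?size_tuple // all_cat.
  by rewrite (introT allP).
by apply: eq_bigr => j _; rewrite -dU subnDl.
Qed.

(** This is the form in which [card_basis_extensions] counts the ways to complete one line: the
    Gaussian factors come in reverse order, and the exponents 1, ..., n - 2 add up to a binomial
    coefficient. *)
Lemma tnumE : tnum F n = (\prod_(j < n - 2) (q ^ j.+1 * gauss q (n - 2 - j)))%N.
Proof.
rewrite /tnum big_split /= -expn_sum; congr (_ ^ _ * _)%N; last first.
  rewrite big_add1 big_mkord subn1 subn2 (reindex_inj rev_ord_inj) /=.
  by apply: eq_bigr => j _; rewrite subnSK.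
rewrite subn1 subn2; case: n => [|[|m]] /=; rewrite ?big_ord0 ?mul0n ?div0n //.
transitivity ('C(m.+1, 2)); first by rewrite bin2 divn2.
by rewrite -bin2_sum big_mkord big_ord_recl.
Qed.

Lemma card_bases_through U i : (1 < n)%N -> \dim U = (n - 1)%N ->
    (v i <= U)%VS ->
  #|[set r : (n - 2).-tuple 'I_N | lines_basis v U (i :: r)]| = tnum F n.
Proof.
move=> n_gt1 dU i_U.
rewrite (@card_basis_extensions U [:: i]) ?tnumE //=.
- by rewrite seq1_free line_gen_neq0.
- by move=> j; rewrite inE => /eqP ->.
- by rewrite dU add1n subnSK.
Qed.

(** The length is a variable equal to a successor because splitting off the head needs a successor,
    which [n - 1] is not syntactically. *)
Lemma card_bases_headed U i k : (1 < n)%N -> \dim U = (n - 1)%N ->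
    (v i <= U)%VS -> k = (n - 2).+1 ->
  #|[set s : k.-tuple 'I_N | (ohead s == Some i) && lines_basis v U s]| = tnum F n.
Proof.
move=> n_gt1 dU i_U ->; rewrite -(card_bases_through _ _ n_gt1 dU i_U).
rewrite -sum1_card big_mkcond big_tuple_cons /= (bigD1 i) //= [X in (_ + X)%N]big1.
  rewrite addn0 -sum1_card [RHS]big_mkcond; apply: eq_bigr => r _.
  by rewrite !inE eqxx.
move=> j /negbTE j_i; apply: big1 => r _; rewrite inE /=.
by rewrite (inj_eq Some_inj) j_i.
Qed.

Lemma card_bases_through2 i j : (1 < n)%N -> i != j ->
  #|[set r : (n - 2).-tuple 'I_N | lines_basis v fullv (i :: j :: r)]| =
  (tnum F n * q ^ (n - 2))%N.
Proof.
move=> n_gt1 i_j; rewrite (@card_basis_extensions _ [:: i; j]) /=.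
(* Starting from two lines instead of one raises the power of q by one in each of the n - 2 factors
   of [tnumE]. *)
- rewrite tnumE -[X in (_ * q ^ X)%N]card_ord -prod_nat_const -big_split /=.
  by apply: eq_bigr => r _; rewrite mulnAC -expnSr addnC addn2.
- rewrite free_cons seq1_free line_gen_neq0 andbT span_seq1 -line_genE.
  apply: contra i_j => i_vj; apply/eqP/(@line_uniq (vv i)) => //.
    exact: line_gen_neq0.
  exact: memv_pick.
- by move=> k _; apply: subvf.
- by rewrite dimvf /dim /= mul1n subnKC.
Qed.

(** * Orthogonal hyperplanes *)

Lemma sub_orth i j : (v i <= orth (v j))%VS = (\sum_k vv j 0 k * vv i 0 k == 0).
Proof. by rewrite sub_line mem_orth. Qed.

Lemma sub_orthC i j : (v i <= orth (v j))%VS = (v j <= orth (v i))%VS.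
Proof.
by rewrite !sub_orth; congr (_ == 0); apply: eq_bigr => k _; rewrite mulrC.
Qed.

(** Rank-nullity for the pairing with the generator of v_i: this functional is nonzero because its
    values on the unit vectors are the coordinates of the generator. *)
Lemma dim_orth i : \dim (orth (v i)) = (n - 1)%N.
Proof.
rewrite /orth; set f : 'Hom(vec, 'rV[F]_1) := linfun _.
have := limg_ker_dim f fullv; rewrite capfv dimvf /dim /= mul1n => def_n.
rewrite -[X in _ = (X - 1)%N]def_n.
rewrite (_ : \dim (limg f) = 1%N) ?addnK //.
apply/eqP; rewrite eqn_leq; apply/andP; split.
  by apply: leq_trans (dimvS (subvf _)) _; rewrite dimvf /dim /= muln1.
rewrite lt0n dimv_eq0; apply: contra (line_gen_neq0 i) => /eqP f0.
apply/eqP/rowP => k; rewrite mxE.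
have : f (delta_mx 0 k) == 0 by rewrite -memv0 -f0 memv_img ?memvf.
rewrite lfunE /= -rowE => /eqP/matrixP/(_ 0 0).
by rewrite !mxE.
Qed.

Lemma orth_inj i j : orth (v i) = orth (v j) -> i = j.
Proof.
move=> eq_orth; have /rV0Pn[k k_neq0] := line_gen_neq0 i.
apply: (@line_uniq (vv j)); [exact: line_gen_neq0| |exact: memv_pick].
rewrite (line_genE i); apply/vlineP; exists (vv j 0 k / vv i 0 k).
apply/rowP => l; rewrite mxE mulrAC; apply: (canRL (mulfK k_neq0)).
(* This vector is orthogonal to the generator of v_i, hence to that of v_j, which says that a 2 by 2
   minor of the two generators vanishes. *)
pose w : vec := vv i 0 k *: delta_mx 0 l - vv i 0 l *: delta_mx 0 k.
have dot (u : vec) : \sum_m u 0 m * w 0 m = u 0 l * vv i 0 k - u 0 k * vv i 0 l.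
  rewrite /w; under eq_bigr => m _ do rewrite !mxE eqxx /= mulrBr.
  rewrite sumrB; congr (_ - _).
    rewrite (bigD1 l) //= eqxx mulr1 big1 ?addr0 // => m /negbTE ->.
    by rewrite !mulr0.
  rewrite (bigD1 k) //= eqxx mulr1 big1 ?addr0 // => m /negbTE ->.
  by rewrite !mulr0.
have : w \in orth (v i) by rewrite mem_orth dot mulrC subrr.
by rewrite eq_orth mem_orth dot subr_eq0 => /eqP.
Qed.

Lemma gauss1 : gauss q 1 = 1%N.
Proof. by rewrite /gauss divnn subn_gt0 q_gt1. Qed.

Lemma card_orth_diff i j : (1 < n)%N -> i != j ->
  #|[set k | (v k <= orth (v i))%VS && ~~ (v k <= orth (v j))%VS]| = (q ^ (n - 2))%N.
Proof.
move=> n_gt1 i_j; set H := orth _; set H' := orth _.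
have dH : \dim H = (n - 1)%N := dim_orth i.
have dH' : \dim H' = (n - 1)%N := dim_orth j.
have neq_H : ~~ (H <= H')%VS.
  apply: contra i_j => sHH'; apply/eqP/orth_inj/eqP.
  by rewrite eqEdim sHH' !dim_orth leqnn.
have dI : \dim (H :&: H') = (n - 2)%N.
  (* Distinct hyperplanes span the whole space, so the dimension formula gives n - 2 for their
     intersection. *)
  have lt_dH : (n - 1 < \dim (H + H'))%N.
    rewrite -dH' ltn_neqAle dimvS ?addvSr // andbT; apply: contra neq_H => /eqP eq_d.
    suff -> : H' = (H + H')%VS by apply: addvSl.
    by apply/eqP; rewrite eqEdim addvSr -eq_d leqnn.
  have := dimv_sum_cap H H'; have := dimvS (subvf (H + H')).
  rewrite dimvf /dim /= mul1n dH dH'.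
  move: (\dim (H + H')) (\dim (H :&: H')) lt_dH => x y; lia.
have -> : [set k | (v k <= H)%VS && ~~ (v k <= H')%VS] =
          [set k | (v k <= H)%VS && ~~ (v k <= H :&: H')%VS].
  by apply/setP => k; rewrite !inE subv_cap; case: (v k <= H)%VS.
rewrite card_lines_diff ?capvSl // dH dI (_ : (n - 1 - (n - 2))%N = 1%N) ?gauss1 ?muln1 //.
lia.
Qed.

Lemma card_not_orth i : (1 < n)%N ->
  #|[set k | ~~ (v k <= orth (v i))%VS]| = (q ^ (n - 1))%N.
Proof.
move=> n_gt1; have := @card_lines_diff fullv (orth (v i)) (subvf _).
rewrite dim_orth dimvf /dim /= mul1n subKn ?(ltnW n_gt1) // gauss1 muln1 => <-.
by apply: eq_card => k; rewrite !inE subvf.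
Qed.

(** The lines outside the second hyperplane are split by membership in the first, and
    [card_orth_diff] counts those inside it. *)
Lemma card_not_orth2 i j : (1 < n)%N -> i != j ->
  #|[set k | ~~ (v k <= orth (v i))%VS && ~~ (v k <= orth (v j))%VS]| =
  (q ^ (n - 1) - q ^ (n - 2))%N.
Proof.
move=> n_gt1 i_j; rewrite -(card_not_orth j n_gt1) -(card_orth_diff i j n_gt1 i_j).
rewrite -[X in (X - _)%N](cardsID [set k | (v k <= orth (v i))%VS]).
rewrite [X in (X + _ - _)%N](eq_card (B :=
  [set k | (v k <= orth (v i))%VS && ~~ (v k <= orth (v j))%VS])).
  by rewrite addKn; apply: eq_card => k; rewrite !inE.
by move=> k; rewrite !inE andbC.
Qed.

End Lines.

(** * Squarefree monomials acting on the bases polynomial *)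

Section Squarefree.
Variables (K : fieldType) (N : nat).
Implicit Types (I : {set 'I_N}) (s : seq 'I_N) (G : {mpoly K[N]}).

Lemma diffact_suml (T : finType) (P : pred T) (G : T -> {mpoly K[N]}) f :
  diffact (\sum_(i | P i) G i) f = \sum_(i | P i) diffact (G i) f.
Proof.
rewrite /diffact exchange_big /=; apply: eq_bigr => m _.
by rewrite raddf_sum scaler_sumr.
Qed.

Lemma diffactU G i : diffact G 'X_i = G^`M(i).
Proof. by rewrite diffactX mderivmU1m. Qed.

Lemma diffact1 G : diffact G 1 = G.
Proof. by rewrite -mpolyX0 diffactX mderivm0m. Qed.

Lemma mderivU i j : ('X_j : {mpoly K[N]})^`M(i) = (i == j)%:R.
Proof.
rewrite mderivX mnm1E eq_sym; case: eqP => [->|_]; last by rewrite scale0r.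
rewrite scale1r (_ : (U_(j) - U_(j))%MM = 0%MM) ?mpolyX0 //.
by apply/mnmP => k; rewrite mnmBE subnn mnm0E.
Qed.

Lemma mderiv_prodX I i :
  (\prod_(j in I) 'X_j : {mpoly K[N]})^`M(i) =
  if i \in I then \prod_(j in I :\ i) 'X_j else 0.
Proof.
have notin J : i \notin J -> (\prod_(j in J) 'X_j : {mpoly K[N]})^`M(i) = 0.
  move=> iNJ; apply: (big_ind (fun p : {mpoly K[N]} => p^`M(i) = 0)).
  - by rewrite -mpolyC1 mderivC.
  - by move=> p r p0 r0; rewrite mderivM p0 r0 mul0r mulr0 addr0.
  - by move=> j jJ; rewrite mderivU; case: eqP => // ij; rewrite ij jJ in iNJ.
case: ifPn => [iI|]; last exact: notin.
rewrite (big_setD1 i) //= mderivM mderivU eqxx mul1r notin ?mulr0 ?addr0 //.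
by rewrite !inE eqxx.
Qed.

(** Each derivative deletes its variable from the product, and gives 0 when that variable is absent
    or already deleted. *)
Lemma diffact_prodX I s :
  diffact (\prod_(j in I) 'X_j) (\prod_(i <- s) 'X_i : {mpoly K[N]}) =
  if uniq s && all (mem I) s then \prod_(j in I :\: [set i in s]) 'X_j else 0.
Proof.
elim: s => [|i s IHs].
  by rewrite big_nil diffact1 /=; apply: eq_bigl => j; rewrite !inE.
rewrite big_cons diffactM diffactU {}IHs /=.
case: (uniq s) => /=; last by rewrite !andbF raddf0.
case: (all _ s) => /=; last by rewrite !andbF raddf0.
rewrite mderiv_prodX !inE !andbT; case: ifP => // _.
by apply: eq_bigl => j; rewrite !inE negb_or andbA.
Qed.

End Squarefree.

Section BasesPoly.
Variables (F : finFieldType) (n : nat) (K : fieldType).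
Variable v : 'I_(nlines F n) -> {vspace 'rV[F]_n}.
Local Notation N := (nlines F n).
Local Notation G := (bases_poly K v).

Lemma lines_basis_perm U (s r : seq 'I_N) : perm_eq s r ->
  lines_basis v U s = lines_basis v U r.
Proof. by move=> eq_sr; apply/perm_basis/perm_map. Qed.

Lemma lines_basis_uniq U (s : seq 'I_N) : lines_basis v U s -> uniq s.
Proof. by move=> /basis_free/free_uniq/map_uniq. Qed.

Lemma diffact_bases_poly (s : seq 'I_N) : size s = (n - 1)%N -> (0 < n)%N ->
  diffact G (\prod_(i <- s) 'X_i) =
  \sum_(k | lines_basis v fullv (k :: s)) 'X_k.
Proof.
move=> size_s n_gt0; rewrite /bases_poly diffact_suml.
transitivity (\sum_(I : {set 'I_N} | (#|I| == n) && lines_basis v fullv (enum I))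
  (if uniq s && all (mem I) s then
     \prod_(j in I :\: [set i in s]) 'X_j else 0 : {mpoly K[N]})).
  apply: eq_bigr => I _; exact: diffact_prodX.
(* With a repeated line both sides are 0. *)
have [s_uniq|s_uniq] := boolP (uniq s) => /=; last first.
  rewrite big1 // big_pred0 // => k; apply: contraNF s_uniq.
  by move=> /lines_basis_uniq /andP[].
rewrite -big_mkcondr /=; set S := [set i in s].
have cS : #|S| = (n - 1)%N by rewrite cardsE (card_uniqP s_uniq).
(* The surviving sets I are S together with one line k outside s, and each leaves the single factor
   X_k. The inverse [h'] is partial: it recovers k from I, and is [None] on [h k] when k is in s. *)
pose h (k : 'I_N) := k |: S.
pose h' (I : {set 'I_N}) : option 'I_N := [pick k in I :\: S].
have enum_h k : k \notin s -> perm_eq (enum (h k)) (k :: s).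
  move=> kNs; apply: uniq_perm; rewrite ?enum_uniq //= ?kNs // => i.
  by rewrite mem_enum !inE.
have h_diff k : k \notin s -> h k :\: S = [set k].
  by move=> kNs; apply/setP => i; rewrite !inE; case: eqP => [->|_]; rewrite ?kNs ?andNb.
have h'E k : h' (h k) = if k \in s then None else Some k.
  rewrite /h'; case: pickP => [i|no_i].
    rewrite !inE => /andP[/negbTE iNs]; rewrite iNs orbF => /eqP def_i.
    by rewrite -def_i iNs.
  by have := no_i k; rewrite !inE eqxx andbT => /negbFE ->.
rewrite (reindex_omap h h') /= => [|I /andP[/andP[/eqP cI _] /allP sI]].
  apply: eq_big => [k|k /andP[_]]; rewrite h'E.
    have [ks|kNs] /= := boolP (k \in s).
      rewrite andbF; apply/esym/negbTE.
      by apply/negP => /lines_basis_uniq /=; rewrite ks.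
    rewrite eqxx (lines_basis_perm _ _ _ (enum_h k kNs)) cardsU1 inE kNs cS.
    rewrite add1n subn1 prednK // eqxx /= !andbT.
    by rewrite (introT allP) ?andbT // => i i_s; rewrite !inE i_s orbT.
  by case: ifPn => // kNs _; rewrite h_diff // big_set1.
have sSI : S \subset I by apply/subsetP => i; rewrite inE => /sI.
have : #|I :\: S| == 1%N by rewrite cardsD (setIidPr sSI) cI cS subKn.
case/cards1P => k def_k; rewrite /h' def_k.
case: pickP => [i|/(_ k)]; last by rewrite !inE eqxx.
rewrite !inE => /eqP ->; congr Some.
by rewrite /h -def_k setUC -{2}(setID I S) (setIidPr sSI).
Qed.

(** Adding v_k to a basis of the hyperplane U gives a basis of the space exactly when v_k is not in
    U. The result depends on U alone, which is why x_j^perp does not depend on the chosen basis. *)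
Lemma diffact_hyperplane_basis U (s : seq 'I_N) : enumerates_lines v ->
    (0 < n)%N -> \dim U = (n - 1)%N -> lines_basis v U s ->
  diffact G (\prod_(i <- s) 'X_i) = \sum_(k | ~~ (v k <= U)%VS) 'X_k.
Proof.
move=> v_enum n_gt0 dU s_basis.
have size_s : size s = (n - 1)%N.
  have := basis_free s_basis.
  by rewrite /free (span_basis s_basis) dU size_map => /eqP.
rewrite diffact_bases_poly //; apply: eq_bigl => k.
rewrite lines_basis_free //=; last first.
  by rewrite size_s dimvf /dim /= mul1n subn1 prednK.
rewrite free_cons (basis_free s_basis) (span_basis s_basis) -(sub_line _ _ _ v_enum) andbT.
by rewrite subvf (introT allP) ?andbT // => i _; exact: subvf.
Qed.

End BasesPoly.

(** * Independence of the x_i^perp and the matrix of the map *)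

Section Main.
Variables (F : finFieldType) (n : nat) (K : fieldType).
Variable v : 'I_(nlines F n) -> {vspace 'rV[F]_n}.
Hypothesis v_enum : enumerates_lines v.
Hypothesis n_gt1 : (1 < n)%N.
Hypothesis K_char0 : [pchar K] =i pred0.
Local Notation q := #|F|.
Local Notation N := (nlines F n).
Local Notation G := (bases_poly K v).

Let q_gt1 : (1 < q)%N := card_finNzRing_gt1 F.
Let n_gt0 : (0 < n)%N := ltnW n_gt1.

Lemma non_incidence_inj (c : 'I_N -> K) :
    (forall k, \sum_j c j * (~~ (v k <= orth (v j))%VS)%:R = 0) ->
  forall j, c j = 0.
Proof.
move=> c_ker.
have natK0 m : (m%:R == 0 :> K) = (m == 0)%N by apply: (proj1 (pcharf0P K)).
pose S := \sum_j c j; pose a : K := (q ^ (n - 2))%:R; pose e : K := (q ^ (n - 1))%:R.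
have a_neq0 : a != 0 by rewrite natK0 -lt0n expn_gt0 (ltnW q_gt1).
have le_ae : (q ^ (n - 2) <= q ^ (n - 1))%N by rewrite leq_exp2l // leq_sub2l.
(* Row i of B^T B c = 0: the diagonal entries are e and the others e - a. *)
have row i : (e - a) * S + a * c i = 0.
  transitivity (\sum_k (~~ (v k <= orth (v i))%VS)%:R *
      \sum_j c j * (~~ (v k <= orth (v j))%VS)%:R); last first.
    by apply: big1 => k _; rewrite c_ker mulr0.
  under [RHS]eq_bigr => k _ do rewrite mulr_sumr.
  rewrite exchange_big /= (bigD1 i) //= {1}/S (bigD1 i) //= mulrDr.
  rewrite addrAC -mulrDl subrK mulr_sumr; congr (_ + _).
    under eq_bigr => k _ do rewrite mulrCA -natrM mulnb andbb.
    rewrite -mulr_sumr mulrC; congr (_ * _).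
    rewrite /e -(card_not_orth _ _ _ v_enum i n_gt1) -sum1_card natr_sum big_mkcond /=.
    by apply: eq_bigr => k _; rewrite inE; case: (v k <= _)%VS.
  apply: eq_bigr => j j_i.
  under eq_bigr => k _ do rewrite mulrCA -natrM mulnb.
  rewrite -mulr_sumr mulrC; congr (_ * _).
  rewrite /e /a -natrB // -(card_not_orth2 _ _ _ v_enum i j) 1?eq_sym //.
  rewrite -sum1_card natr_sum big_mkcond /=.
  by apply: eq_bigr => k _; rewrite inE; case: andP.
have c_const i : c i = - ((e - a) / a * S).
  apply: (mulfI a_neq0); rewrite mulrN mulrA mulrCA divff // mulr1.
  by apply/eqP; rewrite -addr_eq0 addrC row.
(* Summing the rows multiplies S by a positive integer, which is nonzero in characteristic 0. *)
have S0 : S = 0.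
  have : S * (a + N%:R * (e - a)) = 0.
    have : \sum_i ((e - a) * S + a * c i) = 0 by apply: big1 => i _; apply: row.
    rewrite big_split /= sumr_const card_ord -mulr_sumr -/S => <-.
    by rewrite -[X in X + _]mulr_natl; ring.
  move/eqP; rewrite mulf_eq0 => /predU1P[//|/eqP].
  rewrite /e /a -natrB // -natrM -natrD => /eqP; rewrite natK0 addn_eq0.
  by rewrite expn_eq0 eqn0Ngt (ltnW q_gt1).
by move=> j; rewrite c_const S0 mulr0 oppr0.
Qed.

Variable b : 'I_N -> (n - 1).-tuple 'I_N.
Hypothesis b_basis : forall j, lines_basis v (orth (v j)) (b j).

Let xorth j : {mpoly K[N]} := \prod_(i <- b j) 'X_i.

Lemma diffact_xorth j :
  diffact G (xorth j) = \sum_k (~~ (v k <= orth (v j))%VS)%:R *: 'X_k.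
Proof.
rewrite (diffact_hyperplane_basis _ _ _ _ (orth (v j))) ?dim_orth //.
by rewrite big_mkcond; apply: eq_bigr => k _; case: ifP; rewrite ?scale1r ?scale0r.
Qed.

Lemma diffact_sum_xorth (c : 'I_N -> K) :
  diffact G (\sum_j c j *: xorth j) =
  \sum_k (\sum_j c j * (~~ (v k <= orth (v j))%VS)%:R) *: 'X_k.
Proof.
rewrite raddf_sum /=.
under eq_bigr => j _ do rewrite linearZ /= diffact_xorth scaler_sumr.
rewrite exchange_big; apply: eq_bigr => k _; rewrite scaler_suml.
by apply: eq_bigr => j _; rewrite scalerA.
Qed.

Lemma val_sum_xs_orth (c : 'I_N -> K) :
  vsval (\sum_(i < N) c i *: (xs_orth K v b)`_i) = cls G (\sum_j c j *: xorth j).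
Proof.
rewrite !linear_sum; apply: eq_bigr => j _.
by rewrite -tnth_nth tnth_mktuple !linearZ.
Qed.

Lemma sumU_coef (c : 'I_N -> K) k :
  (\sum_j c j *: 'X_j : {mpoly K[N]})@_U_(k) = c k.
Proof.
rewrite raddf_sum (bigD1 k) //= mcoeffZ mcoeffX eqxx mulr1 big1 ?addr0 // => j j_k.
rewrite mcoeffZ mcoeffX; case: eqP => [/mnmP/(_ k)|]; rewrite ?mulr0 //.
by rewrite !mnm1E eqxx (negbTE j_k).
Qed.

(** Acting on the bases polynomial turns a linear relation into a kernel vector of the non-incidence
    matrix. *)
Lemma xs_orth_free : free (xs_orth K v b).
Proof.
apply/freeP => c c0; apply: non_incidence_inj => k.
have /eqP := congr1 vsval c0; rewrite val_sum_xs_orth linear0 cls_eq0.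
by rewrite diffact_sum_xorth => /eqP/(congr1 (mcoeff U_(k))); rewrite sumU_coef mcoeff0.
Qed.

Lemma diffact_ell_pow j :
  diffact G ((\sum_i 'X_i) ^+ (n - 2) * 'X_j) =
  \sum_k (if k == j then 0 else (tnum F n * q ^ (n - 2))%N)%:R *: 'X_k.
Proof.
rewrite exprn_sum_tuple mulr_suml raddf_sum /=.
transitivity (\sum_(s : (n - 2).-tuple 'I_N)
   \sum_k (lines_basis v fullv (k :: j :: s))%:R *: 'X_k : {mpoly K[N]}).
  apply: eq_bigr => s _; rewrite mulrC.
  have -> : 'X_j * \prod_(i <- s) 'X_i = \prod_(i <- j :: s) 'X_i :> {mpoly K[N]}.
    by rewrite big_cons.
  rewrite diffact_bases_poly //=.
    rewrite big_mkcond; apply: eq_bigr => k _.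
    by case: ifP; rewrite ?scale1r ?scale0r.
  by rewrite size_tuple subnSK.
rewrite exchange_big; apply: eq_bigr => k _; rewrite -scaler_suml; congr (_ *: _).
(* For k = j the line is repeated, so no tuple gives a basis. *)
have [->|k_j] := eqVneq k j.
  apply: big1 => s _; case: (boolP (lines_basis _ _ _)) => // /lines_basis_uniq /=.
  by rewrite inE eqxx.
rewrite -(card_bases_through2 _ _ _ v_enum k j) // -sum1_card natr_sum [RHS]big_mkcond.
by apply: eq_bigr => s _; rewrite inE; case: (lines_basis _ _ _).
Qed.

Lemma ell_map_xs j :
  ell_map K v (tnth (xs K v) j) =
  \sum_(i < N) ((tnum F n)%:R * orth_mx K v i j) *: (xs_orth K v b)`_i.
Proof.
apply: val_inj; rewrite [RHS]val_sum_xs_orth [LHS]ell_mapE // tnth_mktuple /=.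
rewrite /ell -linear_sum -rmorphXn -rmorphM; apply/eqP.
rewrite -subr_eq0 -linearB cls_eq0 linearB subr_eq0 /= diffact_ell_pow diffact_sum_xorth.
apply/eqP/eq_bigr => k _; congr (_ *: _).
(* By symmetry of orthogonality, hyperplanes H_i containing v_j but not v_k become lines v_i in H_j
   but not in H_k, which [card_orth_diff] counts. *)
under eq_bigr => i _ do
  rewrite mxE -mulrA -natrM mulnb (sub_orthC _ _ _ v_enum k).
rewrite -mulr_sumr -natr_sum -natrM; congr _%:R.
have [->|k_j] := eqVneq k j.
  by rewrite big1 ?muln0 // => i _; rewrite andbN.
rewrite eq_sym in k_j; congr (_ * _)%N.
rewrite -(card_orth_diff _ _ _ v_enum _ _ n_gt1 k_j) -sum1_card [LHS]big_mkcond.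
by apply: eq_bigr => i _; rewrite inE; case: andP.
Qed.

Lemma mx_ell_map :
  mx_of_hom (xs K v) (xs_orth K v b) (ell_map K v) = (tnum F n)%:R *: orth_mx K v.
Proof.
by apply/matrixP => i j; rewrite !mxE ell_map_xs coord_sum_free ?xs_orth_free // mxE.
Qed.

End Main.

Theorem theorem4p6 (F : finFieldType) (n : nat) (n_ge2 : (2 <= n)%N)
    (v : 'I_(nlines F n) -> {vspace 'rV[F]_n}) (v_enum : enumerates_lines v)
    (K : fieldType) (K_char0 : [pchar K] =i pred0)
    (b : 'I_(nlines F n) -> (n - 1).-tuple 'I_(nlines F n))
    (b_basis : forall j, lines_basis v (orth (v j)) (b j)) :
  let N := nlines F n in
  let t := tnum F n in
  let M := mx_of_hom (xs K v) (xs_orth K v b) (ell_map K v) in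
  let A := orth_mx K v in
  [/\ (* t counts the ordered (n - 1)-tuples of lines that start with a given
         line and form a basis of a given (n - 1)-dimensional subspace *)
      (forall (H : {vspace 'rV[F]_n}) (i : 'I_N),
         \dim H = (n - 1)%N -> (v i <= H)%VS ->
         #|[set s : (n - 1).-tuple 'I_N |
              (ohead s == Some i) && lines_basis v H s]| = t),
      M = t%:R *: A
    & exists dM dA : int,
        [/\ \det M = dM%:~R, \det A = dA%:~R
          & `|dM| = (t ^ N)%:Z * `|dA| ]].
Proof.
move=> N t M A; have MA : M = t%:R *: A by apply: mx_ell_map.
split=> //.
  by move=> H i dH iH; apply: card_bases_headed; rewrite // -subSn.
(* K carries no absolute value, so determinants are compared over the integers, where the 0-1 matrix
   A already lives. *)
pose A0 : 'M[int]_N := \matrix_(i, j) (v i <= orth (v j))%VS%:R.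
have AE : A = map_mx intr A0.
  by apply/matrixP => i j; rewrite !mxE; case: (_ <= _)%VS.
have detA : \det A = (\det A0)%:~R by rewrite AE det_map_mx.
exists ((t ^ N)%:Z * \det A0), (\det A0); split=> //.
  by rewrite MA detZ detA -natrX pmulrn -intrM.
by rewrite normrM.
Qed.
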